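(* Let $n\ge1$, $\lambda\in[0,1)$, and let $A$ be an intuitionistic fuzzy matrix of order $n$. Then the powers $A^m$ of $A$ with respect to the operation $*$ (defined below) converge as $m\to\infty$, i.e. for all $1\le i,j\le n$ both $\lim_{m\to\infty}[A^m]_{ij\mu}$ and $\lim_{m\to\infty}[A^m]_{ij\nu}$ exist; denoting the limit matrix by $\hat A$, for each $1\le j\le n$ we have $\hat A_{rj}=\hat A_{sj}$ for all $1\le r,s\le n$.
   Context: An intuitionistic fuzzy matrix (IFM) of order $n$ is an $n\times n$ matrix with entries $a_{ij}=\langle a_{ij\mu},a_{ij\nu}\rangle$, where $a_{ij\mu},a_{ij\nu}\in[0,1]$ and $a_{ij\mu}+a_{ij\nu}\le1$. For IFMs $A,B$ of order $n$ define $$[A*B]_{ij}=\Big\langle \max_{1\le t\le n}\Big\{\lambda\min(a_{it\mu},b_{tj\mu})+(1-\lambda)\tfrac{a_{it\mu}+b_{tj\mu}}{2}\Big\},\ \min_{1\le t\le n}\Big\{\lambda\max(a_{it\nu},b_{tj\nu})+(1-\lambda)\tfrac{a_{it\nu}+b_{tj\nu}}{2}\Big\}\Big\rangle$$ (the convex combination of the max-min and the maxarithmetic mean-minarithmetic mean operations). Powers: $A^1=A$, $A^k=A^{k-1}*A$ for $k\ge2$. $[X]_{ij\mu}$ and $[X]_{ij\nu}$ denote the two components of the $(i,j)$ entry of $X$. *)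

(* Defs.v *)
From HB Require Import structures.
From mathcomp Require Import all_boot all_order all_algebra.
From mathcomp Require Import all_classical all_reals all_analysis.

Set Implicit Arguments.
Unset Strict Implicit.
Unset Printing Implicit Defensive.

Import Order.TTheory GRing.Theory Num.Theory.
Import numFieldNormedType.Exports.

Local Open Scope ring_scope.

(* An entry <a_mu, a_nu> is the pair (a_mu, a_nu). *)
Definition is_ifm (R : realType) (m n : nat) (A : 'M[R * R]_(m, n)) : Prop :=
  forall i j, [/\ 0 <= (A i j).1 <= 1, 0 <= (A i j).2 <= 1
                & (A i j).1 + (A i j).2 <= 1].

(* Seeding the iterated max/min with the value at ord0 gives the exact maximum
   and minimum of the nonempty family F, with no artificial bound. *)
Definition ord_maxr (R : realType) (n : nat) (F : 'I_n.+1 -> R) : R :=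
  \big[Num.max/F ord0]_(t < n.+1) F t.

Definition ord_minr (R : realType) (n : nat) (F : 'I_n.+1 -> R) : R :=
  \big[Num.min/F ord0]_(t < n.+1) F t.

Definition ifm_mul (R : realType) (n : nat) (lam : R)
    (A B : 'M[R * R]_n.+1) : 'M[R * R]_n.+1 :=
  \matrix_(i, j)
    (ord_maxr (fun t => lam * Num.min (A i t).1 (B t j).1
                        + (1 - lam) * (((A i t).1 + (B t j).1) / 2)),
     ord_minr (fun t => lam * Num.max (A i t).2 (B t j).2
                        + (1 - lam) * (((A i t).2 + (B t j).2) / 2))).

(* Powers start at exponent 1; there is no unit for ifm_mul, and the value A
   at exponent 0 is a junk value. *)
Definition ifm_exp (R : realType) (n : nat) (lam : R)
    (A : 'M[R * R]_n.+1) (k : nat) : 'M[R * R]_n.+1 :=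
  iter k.-1 (fun X => ifm_mul lam X A) A.

(* Main.v *)
(** Every row of [X * A] is the image of the same row of [X] under one map
    that depends on [A] only. In each component this map is a contraction of
    ratio [(1 + lam) / 2 < 1] for the sup norm: [min] and [max] are
    1-Lipschitz, the mean is 1/2-Lipschitz in its first argument, and taking
    the maximum or minimum over [t] does not increase distances. All the rows
    of [A^m] are thus orbits of one contraction and converge to its unique
    fixed point. *)

Require Import Defs.
From HB Require Import structures.
From mathcomp Require Import all_boot all_order all_algebra.
From mathcomp Require Import all_classical all_reals all_analysis.
From mathcomp Require Import lra.

Set Implicit Arguments.
Unset Strict Implicit.
Unset Printing Implicit Defensive.

Import Order.TTheory GRing.Theory Num.Theory.
Import numFieldNormedType.Exports.

Local Open Scope classical_set_scope.
Local Open Scope ring_scope.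

(* Completeness of matrix spaces is in the library, but its join with the
   normed module structure is not. *)
HB.instance Definition _ (R : realType) (m n : nat) :=
  Complete.on (matrix R m n).

Lemma ord_maxr_ge (R : realType) (n : nat) (F : 'I_n.+1 -> R) t :
  F t <= ord_maxr F.
Proof. exact: le_bigmax. Qed.

Lemma ord_minr_le (R : realType) (n : nat) (F : 'I_n.+1 -> R) t :
  ord_minr F <= F t.
Proof. exact: bigmin_le. Qed.

Lemma ord_maxr_le (R : realType) (n : nat) (F : 'I_n.+1 -> R) x :
  (forall t, F t <= x) -> ord_maxr F <= x.
Proof. by move=> Fx; exact: bigmax_le. Qed.

Lemma ord_minr_ge (R : realType) (n : nat) (F : 'I_n.+1 -> R) x :
  (forall t, x <= F t) -> x <= ord_minr F.
Proof. by move=> Fx; exact: le_bigmin. Qed.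

(** For every [t], [F t <= G t + e <= ord_maxr G + e], and symmetrically. The absolute value is
    therefore unfolded into two upper bounds on a maximum. *)
Lemma dist_ord_maxr (R : realType) (n : nat) (F G : 'I_n.+1 -> R) e :
  (forall t, `|F t - G t| <= e) -> `|ord_maxr F - ord_maxr G| <= e.
Proof.
move=> FG; rewrite ler_distl lerBlDr; apply/andP.
split; apply: ord_maxr_le => t; have := FG t; rewrite ler_distl => /andP[].
  by have := ord_maxr_ge F t; lra.
by have := ord_maxr_ge G t; lra.
Qed.

Lemma dist_ord_minr (R : realType) (n : nat) (F G : 'I_n.+1 -> R) e :
  (forall t, `|F t - G t| <= e) -> `|ord_minr F - ord_minr G| <= e.
Proof.
(* Dually, only the second inequality is rearranged, so that both become lower bounds on a
   minimum. *)
move=> FG; rewrite ler_distl -[X in _ && X]lerBlDr; apply/andP.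
split; apply: ord_minr_ge => t; have := FG t; rewrite ler_distl => /andP[].
  by have := ord_minr_le G t; lra.
by have := ord_minr_le F t; lra.
Qed.

Lemma dist_minl (R : realType) (a x y : R) :
  `|Num.min x a - Num.min y a| <= `|x - y|.
Proof.
rewrite ler_norml; have := ler_norm (x - y).
have := ler_norm (y - x); rewrite distrC.
by case: (lerP x a); case: (lerP y a); lra.
Qed.

Lemma dist_maxl (R : realType) (a x y : R) :
  `|Num.max x a - Num.max y a| <= `|x - y|.
Proof.
rewrite ler_norml; have := ler_norm (x - y).
have := ler_norm (y - x); rewrite distrC.
by case: (lerP x a); case: (lerP y a); lra.
Qed.

(** Here [u] and [v] stand for the min or the max of [x] and of [y] with [a], so one bound serves
    both components. The mean cancels [a] and halves [x - y], whence the ratio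
    [lam + (1 - lam) / 2 = (1 + lam) / 2]. *)
Lemma dist_convex_mean (R : realType) (lam u v a x y : R) :
  0 <= lam <= 1 -> `|u - v| <= `|x - y| ->
  `|(lam * u + (1 - lam) * ((x + a) / 2)) -
    (lam * v + (1 - lam) * ((y + a) / 2))| <= (1 + lam) / 2 * `|x - y|.
Proof.
move=> /andP[lam0 lam1] uv.
have -> : lam * u + (1 - lam) * ((x + a) / 2) -
    (lam * v + (1 - lam) * ((y + a) / 2)) =
    lam * (u - v) + (1 - lam) / 2 * (x - y) by lra.
apply: (le_trans (ler_normD _ _)).
rewrite !(normrM, ger0_norm lam0) (ger0_norm (_ : 0 <= 1 - lam)); last lra.
rewrite (ger0_norm (_ : 0 <= 2^-1)); last lra.
by have := ler_wpM2l lam0 uv; lra.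
Qed.

Lemma ler_mx_norm (R : realType) (m n : nat) (M : 'M[R]_(m, n)) e :
  0 <= e -> (forall i j, `|M i j| <= e) -> `|M| <= e.
Proof. by move=> e0 Me; rewrite [leLHS]mx_normrE; apply: bigmax_le. Qed.

Lemma ler_mx_norm_coord (R : realType) (m n : nat) (M : 'M[R]_(m, n)) i j :
  `|M i j| <= `|M|.
Proof.
rewrite [leRHS]mx_normrE.
exact: (le_bigmax _ (fun ij => `|M ij.1 ij.2|) (i, j)).
Qed.

Lemma contraction_iter_cvg (R : realType) (V : completeNormedModType R)
    (f : V -> V) (q : R) : 0 <= q < 1 ->
  (forall x y, `|f x - f y| <= q * `|x - y|) ->
  exists p : V, forall x, iter m f x @[m --> \oo] --> p.
Proof.
move=> /andP[q0 q1] fq.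
have [|//||p _ pf] := @banach_fixed_point R V setT (totalfun f).
- by exists (NngNum q0); split => //= -[x y] _; exact: fq.
- by exists 0.
(* Existence of a fixed point is turned into convergence from every start: each application of [f]
   gains a factor [q], since [p = f p]. *)
have dist x m : `|p - iter m f x| <= geometric `|p - x| q m.
  elim: m => [|m IH]; first by rewrite /geometric/= expr0 mulr1.
  rewrite iterS [in leLHS]pf (le_trans (fq _ _))//.
  by rewrite /geometric/= exprS mulrCA ler_wpM2l.
exists p => x; apply/cvgrPdist_le => e e0.
have : geometric `|p - x| q @ \oo --> 0.
  by apply: cvg_geometric; rewrite ger0_norm.
move/cvgr0_norm_le => /(_ _ e0); apply: filterS => m.
by apply: le_trans; rewrite (le_trans (dist x m)) ?ler_norm.
Qed.

(** Abstracting [agg] and [g] covers the max of the first components and the min of the second at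
    once. As [p] is chosen before [X] and indexed by columns only, the limit depends neither on the
    initial matrix nor on the row; this is what makes the rows of the limit equal. *)
Lemma row_recurrence_cvg (R : realType) (n : nat) (q : R)
    (agg : ('I_n.+1 -> R) -> R) (g : R -> R -> R) (B : 'M[R]_n.+1) :
  0 <= q < 1 ->
  (forall F G e, (forall t, `|F t - G t| <= e) -> `|agg F - agg G| <= e) ->
  (forall a x y, `|g x a - g y a| <= q * `|x - y|) ->
  exists p : 'I_n.+1 -> R, forall X : nat -> 'M[R]_n.+1,
    (forall k i j, X k.+1 i j = agg (fun t => g (X k i t) (B t j))) ->
    forall i j, X k i j @[k --> \oo] --> p j.
Proof.
move=> q01 aggP gP.
pose f (v : 'rV[R]_n.+1) := \row_j agg (fun t => g (v 0 t) (B t j)).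
have [|p pP] := @contraction_iter_cvg R 'rV[R]_n.+1 f q q01.
  move=> x y; apply: ler_mx_norm => [|i j].
    by rewrite mulr_ge0//; case/andP: q01.
  rewrite !mxE; apply: aggP => t; apply: (le_trans (gP _ _ _)).
  rewrite ler_wpM2l//; first by case/andP: q01.
  by have := ler_mx_norm_coord (x - y) 0 t; rewrite !mxE.
exists (p 0) => X XS i j.
(* Rows evolve independently of each other: row [i] is the orbit of its own initial value under
   [f]. *)
have XE k : row i (X k) = iter k f (row i (X 0%N)).
  elim: k => // k IH; rewrite iterS -IH; apply/rowP => l.
  by rewrite !mxE XS; congr agg; apply/funext => t; rewrite mxE.
have -> : (fun k => X k i j) = (fun k => (iter k f (row i (X 0%N))) 0 j).
  by apply/funext => k; rewrite -XE mxE.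
exact: (continuous_cvg _ (@coord_continuous R _ _ 0 j p) (pP _)).
Qed.

Theorem theorem4p5 (R : realType) (n : nat) (lam : R)
    (hlam : 0 <= lam < 1) (A : 'M[R * R]_n.+1) (hA : is_ifm A) :
  exists Ahat : 'M[R * R]_n.+1,
    (forall i j,
       (ifm_exp lam A m i j).1 @[m --> \oo] --> (Ahat i j).1 /\
       (ifm_exp lam A m i j).2 @[m --> \oo] --> (Ahat i j).2) /\
    (forall j r s, Ahat r j = Ahat s j).
Proof.
have q01 : 0 <= (1 + lam) / 2 < 1 by lra.
have lam01 : 0 <= lam <= 1 by lra.
pose gmin x a := lam * Num.min x a + (1 - lam) * ((x + a) / 2).
pose gmax x a := lam * Num.max x a + (1 - lam) * ((x + a) / 2).
have [p pP] := row_recurrence_cvg (map_mx fst A) q01 (@dist_ord_maxr R n)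
  (fun a x y => dist_convex_mean a lam01 (dist_minl a x y) :
     `|gmin x a - gmin y a| <= _).
have [r rP] := row_recurrence_cvg (map_mx snd A) q01 (@dist_ord_minr R n)
  (fun a x y => dist_convex_mean a lam01 (dist_maxl a x y) :
     `|gmax x a - gmax y a| <= _).
exists (\matrix_(i, j) (p j, r j)); split; last by move=> j s t; rewrite !mxE.
move=> i j; rewrite mxE /=.
have expS k : ifm_exp lam A k.+2 = ifm_mul lam (ifm_exp lam A k.+1) A by [].
split.
(* The recurrence starts at exponent 1, exponent 0 being a junk value that also equals [A]; the
   sequence is shifted by one, which leaves its limit unchanged. *)
- have := pP (fun k => map_mx fst (ifm_exp lam A k.+1)) _ i j.
  rewrite -(cvg_shiftS (fun m => (ifm_exp lam A m i j).1)).
  under eq_fun do rewrite mxE; apply => k s t.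
  rewrite expS !mxE; congr ord_maxr; apply/funext => u.
  by rewrite !mxE.
- have := rP (fun k => map_mx snd (ifm_exp lam A k.+1)) _ i j.
  rewrite -(cvg_shiftS (fun m => (ifm_exp lam A m i j).2)).
  under eq_fun do rewrite mxE; apply => k s t.
  rewrite expS !mxE; congr ord_minr; apply/funext => u.
  by rewrite !mxE.
Qed.
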